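(* The algebra $\mathbb{C}[y,\,xy,\,x^{2}y,\,x^{3}y+\alpha x]$, where $\alpha\in\mathbb{C}$, $\alpha\neq 0$, does not contain polynomials that are regular in both variables.
   Context: The algebra $\mathbb{C}[y,\,xy,\,x^{2}y,\,x^{3}y+\alpha x]$ is the $\mathbb{C}$-subalgebra of the polynomial ring $\mathbb{C}[x,y]$ generated by the listed elements, and the variables in question are $x$ and $y$. With respect to the usual grading, $\deg x=1$ and $\deg y=1$, a polynomial $p(x,y)\in\mathbb{C}[x,y]$ of total degree $n$ is said to be regular in $x$ if it contains a term in $x^{n}$; regularity in $y$ is defined in the same way, with $y^{n}$ in place of $x^{n}$.
   Formalization: Regularity is taken only for polynomials of positive total degree, since a nonzero constant has degree 0, contains a term in x^0 and y^0, and lies in the algebra, so it would be regular in both variables. *)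

(* Defs.v *)
From HB Require Import structures.
From mathcomp Require Import all_boot all_order all_algebra.
From mathcomp Require Import reals.
From mathcomp.real_closed Require Import complex.
From mathcomp Require Import mpoly.

Set Implicit Arguments.
Unset Strict Implicit.
Unset Printing Implicit Defensive.

Import GRing.Theory.
Local Open Scope ring_scope.

Inductive gen_subalg (K : nzRingType) (A : algType K) (s : seq A) : A -> Prop :=
| gen_subalg_gen a : a \in s -> gen_subalg s a
| gen_subalg1 : gen_subalg s 1
| gen_subalgD a b : gen_subalg s a -> gen_subalg s b -> gen_subalg s (a + b)
| gen_subalgM a b : gen_subalg s a -> gen_subalg s b -> gen_subalg s (a * b)
| gen_subalgZ c a : gen_subalg s a -> gen_subalg s (c *: a).

Definition xvar : 'I_2 := ord0.
Definition yvar : 'I_2 := ord_max.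

(* [msize p = n.+1] says that [p] is nonzero of total degree [n]. The condition
   [0 < n] is needed since a nonzero constant, which lies in every subalgebra,
   would otherwise be regular in every variable through its term in 'X_i ^+ 0. *)
Definition regular_in (K : nzRingType) (m : nat) (i : 'I_m) (p : {mpoly K[m]}) :=
  exists n : nat, [/\ (0 < n)%N, msize p = n.+1 & p@_(U_(i) *+ n) != 0].

Definition alg_gens (K : comNzRingType) (alpha : K) : seq {mpoly K[2]} :=
  let x := 'X_xvar in let y := 'X_yvar in
  [:: y; x * y; x ^+ 2 * y; x ^+ 3 * y + alpha *: x].

(* Main.v *)
Require Import Defs.
From mathcomp Require Import all_boot all_order all_algebra.
From mathcomp Require Import reals zify.
From mathcomp.real_closed Require Import complex.
From mathcomp Require Import mpoly.
Local Open Scope ring_scope.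

(** Let [t] be an indeterminate and restrict polynomials to the curve
    [x ^ 2 * y = - alpha], parametrised by [x = 1 / t] and [y = - alpha * t ^ 2].
    There the four generators become [- alpha * t ^ 2], [- alpha * t], [- alpha]
    and [0], so an element of the algebra restricts to a polynomial in [t]: it
    has no pole at [t = 0] ([restr_alg_gens]).  A polynomial [p] with a term in
    [x ^ n], [n > 0] being its total degree, does have a pole of order [n] there:
    a monomial [x ^ i * y ^ j] restricts to a multiple of [t ^ (2 j - i)], and
    [i + j <= n] forces [2 j - i > - n] except for [x ^ n] itself, so nothing
    can cancel the pole ([clear_pole], [clear_pole0]).  Hence no element of the
    algebra is regular in [x] ([alg_gens_not_regular_x]), and a fortiori none is
    regular in both variables. *)

Import GRing.Theory.

Local Notation "x %:F" := (tofrac x).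

Section RestrictionToCurve.

Variables (K : idomainType) (alpha : K).

Definition curve_pt (i : 'I_2) : {fraction {poly K}} :=
  if i == xvar then ('X%:F)^-1 else (- alpha%:P * 'X^2)%:F.

Definition restr (p : {mpoly K[2]}) : {fraction {poly K}} :=
  mmap (@tofrac {poly K} \o polyC) curve_pt p.

Lemma tofracX_neq0 : ('X%:F : {fraction {poly K}}) != 0.
Proof. by rewrite tofrac_eq0 polyX_eq0. Qed.

Lemma restr_x : restr 'X_xvar = ('X%:F)^-1.
Proof. by rewrite /restr mmapX mmap1U. Qed.

Lemma restr_y : restr 'X_yvar = (- alpha%:P * 'X^2)%:F.
Proof. by rewrite /restr mmapX mmap1U. Qed.

Lemma restrD p q : restr (p + q) = restr p + restr q.
Proof. exact: mmapD. Qed.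

Lemma restrM p q : restr (p * q) = restr p * restr q.
Proof. by rewrite /restr rmorphM. Qed.

Lemma restrZ c p : restr (c *: p) = (c%:P)%:F * restr p.
Proof. by rewrite /restr mmapZ. Qed.

(** The last generator is [x * (x ^ 2 * y + alpha)], which vanishes on the
    curve; in the others [x] occurs with at most twice the exponent of [y]. *)
Lemma restr_alg_gens p :
  gen_subalg (alg_gens alpha) p -> exists q : {poly K}, restr p = q%:F.
Proof.
elim=> {p} [p||p1 p2 _ [q1 e1] _ [q2 e2]|p1 p2 _ [q1 e1] _ [q2 e2]|c p _ [q e]].
- have xK := mulVf tofracX_neq0.
  have x2y : restr ('X_xvar ^+ 2 * 'X_yvar) = (- alpha%:P)%:F.
    rewrite expr2 !restrM restr_x restr_y tofracM tofracXn expr2.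
    by rewrite mulrCA mulrACA xK !mulr1.
  rewrite !inE => /or4P[] /eqP->.
  + by exists (- alpha%:P * 'X^2); rewrite restr_y.
  + exists (- alpha%:P * 'X).
    by rewrite restrM restr_x restr_y !tofracM mulrCA [_^-1 * _]mulrA xK mul1r.
  + by exists (- alpha%:P).
  + exists 0.
    rewrite restrD restrZ exprS -mulrA restrM x2y restr_x.
    by rewrite mulrC tofracN mulNr addNr tofrac0.
- by exists 1; rewrite /restr rmorph1 tofrac1.
- by exists (q1 + q2); rewrite restrD e1 e2 tofracD.
- by exists (q1 * q2); rewrite restrM e1 e2 tofracM.
- by exists (c%:P * q); rewrite restrZ e tofracM.
Qed.

(** The monomial [x ^ i * y ^ j] restricts to [(- alpha) ^ j * t ^ (2 j - i)];
    the truncated subtraction is a true one as long as [i <= n]. *)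
Definition clear_pole n (p : {mpoly K[2]}) : {poly K} :=
  \sum_(m <- msupp p) (p@_m * (- alpha) ^+ m yvar) *: 'X^(n - m xvar + m yvar * 2).

Lemma lift00_yvar : lift ord0 ord0 = yvar.
Proof. exact: val_inj. Qed.

Lemma mdeg_xy (m : 'X_{1..2}) : mdeg m = (m xvar + m yvar)%N.
Proof. by rewrite mdegE big_ord_recl big_ord1 lift00_yvar. Qed.

(** In a polynomial of degree at most [n] every monomial has [i <= n], so the
    factor [t ^ n] absorbs all the poles of its restriction. *)
Lemma clear_poleE n p : (msize p <= n.+1)%N ->
  ('X^n)%:F * restr p = (clear_pole n p)%:F.
Proof.
move=> size_p; rewrite /restr /mmap /clear_pole rmorph_sum mulr_sumr.
apply: eq_big_seq => m mp /=.
have le_mx_n : (m xvar <= n)%N.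
  have := leq_trans (msize_mdeg_lt mp) size_p.
  by rewrite ltnS mdeg_xy; apply/leq_trans/leq_addr.
have -> : mmap1 curve_pt m =
    ('X%:F ^- m xvar) * (- alpha%:P * 'X^2)%:F ^+ m yvar.
  by rewrite /mmap1 big_ord_recl big_ord1 lift00_yvar /= exprVn.
rewrite -mul_polyC polyCM polyC_exp polyCN exprD mulnC exprM !tofracM.
rewrite -[in LHS](subnK le_mx_n) exprD tofracM exprMn !tofracXn.
have := expf_neq0 (m xvar) tofracX_neq0.
set u := 'X%:F ^+ m xvar => u0.
rewrite -!mulrA [u * _]mulrCA [u * _]mulrA divff // mul1r.
by rewrite -expr2 [LHS]mulrCA; congr (_ * _); rewrite [LHS]mulrCA.
Qed.

(** Since [i + j <= n], the exponent [n - i + 2 j] vanishes only for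
    [i = n] and [j = 0]. *)
Lemma clear_pole0 n p : (msize p <= n.+1)%N ->
  (clear_pole n p)`_0 = p@_(U_(xvar) *+ n).
Proof.
move=> size_p; rewrite [in RHS](mpolyE p) /clear_pole coef_sum linear_sum /=.
apply: eq_big_seq => m /msize_mdeg_lt/leq_trans/(_ size_p).
rewrite ltnS mdeg_xy coefZ coefXn mcoeffZ mcoeffX => le_m_n.
have -> : (0 == n - m xvar + m yvar * 2)%N = (m == U_(xvar) *+ n)%MM.
  apply/idP/eqP => [e0|->]; last by rewrite !mulmnE !mnm1E mul1n subnn.
  have [my0 mx_n] : m yvar = 0%N /\ m xvar = n by lia.
  apply/mnmP => i; rewrite mulmnE mnm1E.
  have /orP[/eqP->|/eqP->] : (i == xvar) || (i == yvar) by case: i => [[|[|]]].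
    by rewrite eqxx mul1n.
  by rewrite my0.
case: eqP => [->|_]; last by rewrite !mulr0.
by rewrite mulmnE mnm1E mul0n expr0 mulr1.
Qed.

(** If [restr p] is a polynomial [q] and [n > 0], then [clear_pole n p] is
    [t ^ n * q], with constant coefficient [0] where regularity in [x] asks for
    a nonzero one. *)
Lemma alg_gens_not_regular_x p :
  gen_subalg (alg_gens alpha) p -> ~ regular_in xvar p.
Proof.
move=> /restr_alg_gens[q pq] [n [n_gt0 size_p]]; apply/negP; rewrite negbK.
have size_p' : (msize p <= n.+1)%N by rewrite size_p.
rewrite -clear_pole0 //.
have /eqP := clear_poleE _ _ size_p'.
by rewrite pq -tofracM tofrac_eq => /eqP<-; rewrite coefXnM n_gt0.
Qed.

End RestrictionToCurve.

Theorem lemma3p11 (R : realType) (alpha : R[i]) (halpha : alpha != 0) :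
  ~ exists p : {mpoly (R[i])[2]},
      [/\ gen_subalg (alg_gens alpha) p,
          regular_in xvar p
        & regular_in yvar p].
Proof.
by case=> p [/alg_gens_not_regular_x p_notreg /p_notreg].
Qed.
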